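(* For every $\theta > 0$ there exists a constant $D_{\theta} > 0$, depending only on $\theta$, such that for every real $x \geq 1$ there is an element of the set $$\{u^{\theta}+v^{\theta}:\ u,v \in \mathbb{N}\cup\{0\}\}$$ in the interval $[x,\,x+D_{\theta}\cdot x^{\Psi(\theta)}]$, where $$\Psi(\theta) = \begin{cases} 1-\frac{3}{2\theta} & 0<\theta<1,\\ 0 & \theta =1,\\ 1-\frac{3}{2\theta} & 1 < \theta < 2,\\ 1-\frac{2}{\theta}+\frac{1}{\theta^2} & \theta \geq 2. \end{cases}$$
   Context: $\mathbb{N}=\{1,2,\ldots\}$, and $0^\theta=0$ for $\theta>0$. *)

(* Defs.v *)
From mathcomp Require Import all_boot all_order all_algebra.
From mathcomp Require Import all_classical all_reals all_analysis.

Set Implicit Arguments.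
Unset Strict Implicit.
Unset Printing Implicit Defensive.

Import Order.TTheory GRing.Theory Num.Theory.
Local Open Scope classical_set_scope.
Local Open Scope ring_scope.

(* [0 `^ theta = 0] for [theta != 0] (powR0), matching the convention
   0^theta = 0 for theta > 0; the natural numbers [u, v] include 0. *)
Definition sums_of_two_powers (R : realType) (theta : R) : set R :=
  [set y | exists u v : nat, y = u%:R `^ theta + v%:R `^ theta].

(* Only meaningful for [0 < theta]. *)
Definition Psi (R : realType) (theta : R) : R :=
  if theta < 1 then 1 - 3 / (2 * theta)
  else if theta == 1 then 0
  else if theta < 2 then 1 - 3 / (2 * theta)
  else 1 - 2 / theta + 1 / theta ^+ 2.

(* Main.v *)
Require Import Defs.
From mathcomp Require Import all_boot all_order all_algebra.
From mathcomp Require Import all_classical all_reals all_analysis.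
From mathcomp Require Import ring lra zify.

Import Order.TTheory GRing.Theory Num.Theory.
Local Open Scope classical_set_scope.
Local Open Scope ring_scope.

(** Two constructions cover all exponents.

    For [theta >= 1] the greedy choice works ([greedy_two_powers]).  Put
    [X = x^(1/theta)] and let [u] be the integer part of [X].  The remainder
    [r = x - u^theta] is at most [theta * X^(theta - 1)], because consecutive
    theta-th powers near [X] are that close.  For the same reason the first
    theta-th power [v^theta] above [r] overshoots [r] by at most
    [theta * (r^(1/theta) + 1)^(theta - 1)], hence by a constant times
    [x^((1 - 1/theta)^2)], and [(1 - 1/theta)^2 = 1 - 2/theta + 1/theta^2].
    At [theta = 1] this exponent is [0], as required there.

    For [0 < theta < 2] with [theta <> 1] the solutions lie near the diagonal
    ([diagonal_two_powers]).  Write [x = 2 * z^theta], let [j] be an integer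
    within distance [1] of [z], and consider
    [F k = (j + k)^theta + (j - k)^theta].  The first-order terms cancel, so
    [F k - F (k - 1)] has the sign of [theta - 1] and size about
    [k * j^(theta - 2)] ([diag_sum_step]), whence [F k - F 0] has size about
    [k^2 * j^(theta - 2)] ([diag_sum_growth]).  The distance from [F 0] to [x]
    is [O(j^(theta - 1))], so as [k] runs up to a large multiple of [sqrt j]
    the values [F k] pass over [x], in steps
    [O(sqrt j * j^(theta - 2)) = O(j^(theta - 3/2))]
    ([two_powers_crossing]).  Finally [j^(theta - 3/2)] is comparable with
    [x^(1 - 3/(2 theta))].

    The sign of [theta - 1] decides on which side of [z] the integer [j] must be
    taken, and which of the two values of [F] enclosing [x] is the answer;
    dividing all differences by [theta * (theta - 1)] makes the two cases
    alike.  Bounded [x] are absorbed into the constant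
    ([two_powers_bounded_range]). *)

(** * Real powers *)

Lemma powR_sub_MVT (R : realType) (p a b : R) : 0 < a -> a <= b ->
  exists2 c, a <= c <= b & b `^ p - a `^ p = p * c `^ (p - 1) * (b - a).
Proof.
move=> a0 ab.
have dpow x : a <= x -> is_derive x 1 (@powR R ^~ p) (p * x `^ (p - 1)).
  by move=> ax; apply: is_derive1_powR; exact: lt_le_trans ax.
have [||c] := @MVT_segment R (@powR R ^~ p) (fun x => p * x `^ (p - 1)) a b ab.
- by move=> x; rewrite in_itv/= => /andP[/ltW ax _]; exact: dpow.
- apply: derivable_within_continuous => x; rewrite in_itv/= => /andP[ax _].
  by case: (dpow x ax).
- by rewrite in_itv/= => ? ?; exists c.
Qed.

(** Nearby bases have comparable powers, with one formula for both signs of the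
    exponent; the hypotheses are symmetric in [a] and [w], so the lemma also
    gives lower bounds. *)
Lemma powR_le_scale (R : realType) (p c a w : R) :
  0 < a -> 0 < w -> 1 <= c -> a <= c * w -> w <= c * a ->
  w `^ p <= c `^ `|p| * a `^ p.
Proof.
move=> a0 w0 c1 acw wca.
have c0 : 0 <= c by lra.
have homo r x y : 0 <= r -> 0 < x -> 0 < y -> x <= c * y ->
    x `^ r <= c `^ r * y `^ r.
  move=> r0 x0 y0 xy; rewrite -powRM// ?(ltW y0)//.
  by apply: ge0_ler_powR; rewrite ?nnegrE ?mulr_ge0 // ltW.
have [p0|p0] := leP 0 p; first by rewrite ger0_norm// homo.
have aw : a `^ (- p) <= c `^ (- p) * w `^ (- p) by apply: homo => //; lra.
rewrite ltr0_norm//.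
have -> : w `^ p = (w `^ (- p))^-1 by rewrite powRN invrK.
have -> : a `^ p = (a `^ (- p))^-1 by rewrite powRN invrK.
by rewrite ler_pdivlMr ?powR_gt0// mulrC ler_pdivrMr ?powR_gt0.
Qed.

(** * Sums of two powers near the diagonal *)

Lemma nat_crossing (R : realType) (S : nat -> R) (P : R) (K : nat) :
  S 0%N <= P -> P <= S K ->
  (0 < K)%N -> exists2 k, (k < K)%N & S k <= P <= S k.+1.
Proof.
move=> S0; elim: K => // K IH PK _.
have [SKP|PSK] := leP (S K) P; first by exists K => //; rewrite SKP.
case: K IH PK PSK => [|K] IH PK PSK; first by rewrite ltNge S0 in PSK.
by have [//|k kK ?] := IH (ltW PSK); exists k => //; exact: ltnW.
Qed.

(** For [k <= j], the sum at the lattice point obtained from the diagonal point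
    [(j, j)] by [k] steps along the antidiagonal. *)
Definition diag_sum {R : realType} (theta : R) (j k : nat) : R :=
  (j + k)%:R `^ theta + (j - k)%:R `^ theta.

(** The mean value theorem turns the increment into [theta] times a difference
    of two values of [y^(theta - 1)], taken at distance between [2k] and
    [2k + 2]; applied again to that difference, it produces [theta - 1] and
    a value of [y^(theta - 2)].  All points stay in [[j/2, 2j]] because
    [k + 1 <= j/2], so that value is [j^(theta - 2)] up to a constant.  Keeping
    [theta * (theta - 1)] apart makes [Q] nonnegative for every [theta]. *)
Lemma diag_sum_step (R : realType) (theta : R) (j k : nat) : (k.+1.*2 <= j)%N ->
  exists2 Q : R,
    diag_sum theta j k.+1 - diag_sum theta j k = theta * (theta - 1) * Q &
    k.*2%:R * j%:R `^ (theta - 2) <= 2 `^ `|theta - 2| * Q /\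
    Q <= 2 `^ `|theta - 2| * (k.+1.*2%:R * j%:R `^ (theta - 2)).
Proof.
move=> kj; rewrite /diag_sum !natrD !natrB; [|lia..].
have : (k.+1.*2%:R : R) <= j%:R by rewrite ler_nat.
have : 0 <= (k%:R : R) by [].
rewrite -!muln2 !natrM -[k.+1%:R]natr1.
set t := k%:R; set m := j%:R => t0 tm.
have [||xi /andP[xi1 xi2] Exi] := @powR_sub_MVT R theta (m + t) (m + (t + 1));
  [lra..|].
have [||eta /andP[eta1 eta2] Eeta] :=
  @powR_sub_MVT R theta (m - (t + 1)) (m - t); [lra..|].
have [||zeta /andP[zeta1 zeta2] Ezeta] := @powR_sub_MVT R (theta - 1) eta xi;
  [lra..|].
exists (zeta `^ (theta - 2) * (xi - eta)).
  have -> : theta - 2 = theta - 1 - 1 by ring.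
  transitivity (theta * (xi `^ (theta - 1) - eta `^ (theta - 1))).
    transitivity (((m + (t + 1)) `^ theta - (m + t) `^ theta)
       - ((m - t) `^ theta - (m - (t + 1)) `^ theta)); first by ring.
    by rewrite Exi Eeta; ring.
  by rewrite Ezeta; ring.
have up : zeta `^ (theta - 2) <= 2 `^ `|theta - 2| * m `^ (theta - 2).
  by apply: powR_le_scale; lra.
have low : m `^ (theta - 2) <= 2 `^ `|theta - 2| * zeta `^ (theta - 2).
  by apply: powR_le_scale; lra.
have z0 := powR_ge0 zeta (theta - 2); have m0 := powR_ge0 m (theta - 2).
split.
- by rewrite mulrA [leLHS]mulrC ler_pM//; lra.
- by rewrite [leRHS]mulrCA [leRHS]mulrC ler_pM//; lra.
Qed.

Lemma diag_sum_growth (R : realType) (theta : R) (j k : nat) : (k.*2 <= j)%N ->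
  exists2 Q : R,
    diag_sum theta j k - diag_sum theta j 0 = theta * (theta - 1) * Q &
    k%:R * (k%:R - 1) * j%:R `^ (theta - 2) <= 2 `^ `|theta - 2| * Q.
Proof.
elim: k => [_|k IH kj]; first by exists 0; rewrite ?subrr ?mulr0// !mul0r.
have [|Q1 E1 le1] := IH; first by lia.
have [Q2 E2 [le2 _]] := @diag_sum_step R theta j k kj.
exists (Q1 + Q2); first by rewrite mulrDr -E1 -E2; ring.
rewrite [leRHS]mulrDr; apply: le_trans (lerD le1 le2).
by rewrite -mulrDl ler_wpM2r ?powR_ge0// -natr1 -muln2 natrM; nra.
Qed.

(** After [A * s] steps, with [s] of order [sqrt j], the sums have moved by a
    quantity of order [A^2 * j^(theta - 1)].  The hypothesis on [A] makes this
    exceed the initial distance to [2 * z^theta], so the target is crossed; no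
    step is longer than order [A * j^(theta - 3/2)].  The sign condition on
    [z - j] says that the sums start on the side of the target from which
    they move towards it. *)
Lemma two_powers_crossing (R : realType) (theta : R) (A s j : nat) (z : R) :
  0 < theta -> theta != 1 -> (1 < A)%N -> (0 < s)%N ->
  16 * 2 `^ `|theta - 2| * 2 `^ `|theta - 1| <= `|theta - 1| * A%:R ^+ 2 ->
  (s ^ 2 <= j)%N -> (j <= 4 * s ^ 2)%N -> ((A * s).*2 <= j)%N ->
  `|z - j%:R| <= 1 -> 0 <= (theta - 1) * (z - j%:R) ->
  exists2 k, (k <= A * s)%N &
    2 * z `^ theta <= diag_sum theta j k <=
    2 * z `^ theta +
      theta * `|theta - 1| * 2 `^ `|theta - 2| * 2 * A%:R
        * j%:R `^ (theta - 3 / 2).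
Proof.
move=> th0 th1 A1 s1 hA sj js Asj zj1 zj.
set m : R := j%:R in zj1 zj *.
set q := 2 `^ `|theta - 2| in hA *; set r := 2 `^ `|theta - 1| in hA.
have q0 : 0 < q by apply: powR_gt0.
have r0 : 0 < r by apply: powR_gt0.
have d0 : 0 < `|theta - 1| by rewrite normr_gt0 subr_eq0.
have m2 : 2 <= m by rewrite ler_nat; nia.
have m0 : 0 < m by lra.
have z1 : m - 1 <= z <= m + 1 by move: zj1; rewrite ler_norml; lra.
(* [P] is the initial distance to the target in units of
   [theta * (theta - 1)]; [S k] below is the distance travelled in the same
   units. *)
have [P EP /andP[P0 PP]] : exists2 P, 2 * z `^ theta - diag_sum theta j 0
    = theta * (theta - 1) * P &
    0 <= P <= 2 * r * m `^ (theta - 1) / `|theta - 1|.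
  have [c c1 Ec] : exists2 c, m / 2 <= c <= 2 * m &
      z `^ theta - m `^ theta = theta * c `^ (theta - 1) * (z - m).
    have [mz|zm] := leP m z.
      by have [//|//|c c1 ->] := @powR_sub_MVT R theta m z; exists c => //; lra.
    have [||c c1 Ec] := @powR_sub_MVT R theta z m; [lra|exact: ltW|].
    by exists c; [lra|rewrite -[LHS]opprB Ec; ring].
  exists (2 * c `^ (theta - 1) * ((theta - 1) * (z - m)) / `|theta - 1| ^+ 2).
    rewrite /diag_sum addn0 subn0 real_normK ?num_real//.
    transitivity (2 * (z `^ theta - m `^ theta)); first by rewrite /m; ring.
    by rewrite Ec; field; rewrite subr_eq0.
  have cr : c `^ (theta - 1) <= r * m `^ (theta - 1).
    by apply: powR_le_scale; lra.
  have c0 := powR_ge0 c (theta - 1).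
  have n0 : 0 <= 2 * c `^ (theta - 1) * ((theta - 1) * (z - m)).
    by rewrite mulr_ge0// mulr_ge0.
  rewrite divr_ge0 ?exprn_ge0//= ler_pdivrMr ?exprn_gt0//.
  have zd : (theta - 1) * (z - m) <= `|theta - 1|.
    by apply: le_trans (ler_norm _) _; rewrite normrM -[leRHS]mulr1 ler_wpM2l.
  apply: le_trans (_ : 2 * (r * m `^ (theta - 1)) * `|theta - 1| <= _).
    by rewrite ler_pM// ?mulr_ge0// ler_pM2l.
  by rewrite [in leRHS]expr2 [leRHS]mulrA mulfVK ?gt_eqF// mulrA.
set K := (A * s)%N in Asj *.
have th1' : theta - 1 != 0 by rewrite subr_eq0.
pose S k := (diag_sum theta j k - diag_sum theta j 0) / (theta * (theta - 1)).
have SE k : diag_sum theta j k = diag_sum theta j 0 + theta * (theta - 1) * S k.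
  by rewrite /S; field; rewrite th1' gt_eqF.
have msplit : m `^ (theta - 1) = m * m `^ (theta - 2).
  have -> : theta - 1 = 1 + (theta - 2) by ring.
  by rewrite (@powRD _ m 1) ?powRr1 ?(gt_eqF m0) ?implybT//.
have PSK : P <= S K.
  have [Q EQ lQ] := @diag_sum_growth R theta j K Asj.
  have -> : S K = Q by rewrite /S EQ; field; rewrite th1' gt_eqF.
  apply: le_trans PP _; rewrite ler_pdivrMr// -(ler_pM2l q0).
  apply: le_trans (_ : `|theta - 1| *
      (K%:R * (K%:R - 1) * m `^ (theta - 2)) <= _); last first.
    by rewrite [leRHS]mulrA [leRHS]mulrC ler_pM2l.
  rewrite msplit !mulrA ler_wpM2r ?powR_ge0//.
  have K2 : 2 <= (K%:R : R) by rewrite ler_nat (@leq_mul 2 1).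
  have mK : m * A%:R ^+ 2 <= 4 * K%:R ^+ 2.
    by rewrite -!natrX -!natrM ler_nat expnMn mulnCA mulnC leq_mul2l js orbT.
  have := ler_wpM2l (ltW m0) hA => hA'.
  have KK : K%:R ^+ 2 <= 2 * (K%:R * (K%:R - 1)) :> R.
    by have := ler_wpM2l (ler0n R K) K2; lra.
  have := ler_wpM2l (ltW d0) mK => mK'.
  have := ler_wpM2l (ltW d0) KK => KK'.
  lra.
have S0 : S 0%N = 0 by rewrite /S subrr mul0r.
have [||k kK /andP[SkP PSk]] := @nat_crossing R S P K _ PSK.
- by rewrite S0.
- by rewrite muln_gt0 s1 ltnW.
have [|Q EQ [_ lQ]] := @diag_sum_step R theta j k.
  by apply: leq_trans Asj; rewrite leq_double.
have ESk : S k.+1 - S k = Q.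
  by rewrite /S -mulrBl opprB addrA subrK EQ; field; rewrite th1' gt_eqF.
have step : theta * `|theta - 1| * Q <=
    theta * `|theta - 1| * q * 2 * A%:R * m `^ (theta - 3 / 2).
  rewrite -!mulrA !ler_pM2l//; apply: le_trans lQ _.
  rewrite ler_pM2l// -/m.
  have -> : theta - 3 / 2 = theta - 2 + 2^-1 by field.
  rewrite (@powRD _ m (theta - 2)) ?(gt_eqF m0) ?implybT// powR12_sqrt//.
  have sm : (s%:R : R) <= Num.sqrt m.
    by rewrite -[leLHS]ger0_norm// -sqrtr_sqr ler_wsqrtr// -natrX ler_nat.
  have ks : k.+1%:R <= A%:R * Num.sqrt m.
    apply: le_trans (_ : A%:R * s%:R <= _); last by rewrite ler_wpM2l.
    by rewrite -natrM ler_nat.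
  rewrite -muln2 natrM.
  have w0 := powR_ge0 m (theta - 2).
  have := ler_wpM2r w0 ks; lra.
have tP : theta * `|theta - 1| * (P - S k) <= theta * `|theta - 1| * Q.
  by rewrite ler_wpM2l ?mulr_ge0 ?(ltW th0)//; lra.
have tS : theta * `|theta - 1| * (S k.+1 - P) <= theta * `|theta - 1| * Q.
  by rewrite ler_wpM2l ?mulr_ge0 ?(ltW th0)//; lra.
have P1 : 0 <= theta * `|theta - 1| * (P - S k).
  by rewrite !mulr_ge0 ?(ltW th0)//; lra.
have P2 : 0 <= theta * `|theta - 1| * (S k.+1 - P).
  by rewrite !mulr_ge0 ?(ltW th0)//; lra.
have Ez : 2 * z `^ theta = diag_sum theta j 0 + theta * (theta - 1) * P.
  by rewrite -EP; ring.
have [th|th] := leP 0 (theta - 1).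
(* The sums increase when [theta > 1], and decrease otherwise: the value just
   above the target is the later one or the earlier one. *)
- exists k.+1 => //; rewrite (SE k.+1) Ez.
  by move: step tS P2; rewrite (ger0_norm th); lra.
- exists k; first exact: ltnW.
  by rewrite (SE k) Ez; move: step tP P1; rewrite (ltr0_norm th); lra.
Qed.

Lemma nat_sqrt (j : nat) : exists s : nat, (s ^ 2 <= j < s.+1 ^ 2)%N.
Proof.
elim: j => [|j [s /andP[sj js]]]; first by exists 0%N.
have [le|lt] := leqP (s.+1 ^ 2) j.+1.
  by exists s.+1; rewrite le; move: js; rewrite !expnS; nia.
by exists s; rewrite lt leqW.
Qed.

(** The lower bound on [z] ensures that [j >= 4 A^2]; then the integer square
    root [s] of [j] satisfies [2 A <= s], and the [A s] steps needed stay within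
    the range [A s <= j/2] where the increments are controlled. *)
Lemma two_powers_near_diagonal (R : realType) (theta : R) :
  0 < theta -> theta != 1 -> exists (C : R) (Z0 : nat), 0 < C /\
    forall z : R, Z0%:R <= z -> exists2 y, sums_of_two_powers theta y &
      2 * z `^ theta <= y <= 2 * z `^ theta + C * z `^ (theta - 3 / 2).
Proof.
move=> th0 th1.
have d0 : 0 < `|theta - 1| by rewrite normr_gt0 subr_eq0.
set W := 16 * 2 `^ `|theta - 2| * 2 `^ `|theta - 1| / `|theta - 1| : R.
pose A := (Num.truncn W).+2.
have WA : 16 * 2 `^ `|theta - 2| * 2 `^ `|theta - 1|
    <= `|theta - 1| * A%:R ^+ 2.
  rewrite [leRHS]mulrC -ler_pdivrMr// -/W.
  apply: le_trans (ltW (truncnS_gt W)) _.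
  by rewrite -natrX ler_nat expnS expn1; apply: leq_trans (leq_pmulr _ _).
exists (theta * `|theta - 1| * 2 `^ `|theta - 2| * 2 * A%:R
          * 2 `^ `|theta - 3 / 2|), (4 * A ^ 2).+2.
split; first by rewrite !mulr_gt0 ?powR_gt0.
move=> z Zz; have z2 : 2 <= z by apply: le_trans Zz; rewrite ler_nat.
have z0 : 0 <= z by lra.
have nz : ((4 * A ^ 2).+2 <= Num.truncn z)%N by rewrite truncn_ge_nat.
have /andP[tz zt] := truncn_itv z0; rewrite -natr1 in zt.
(* [j] is on the left of [z] for increasing sums, on the right for decreasing
   ones. *)
have [j [Aj zj1 zj]] : exists j, [/\ (4 * A ^ 2 <= j)%N, `|z - j%:R| <= 1 &
    0 <= (theta - 1) * (z - j%:R)].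
  have [th|th] := leP 1 theta.
    exists (Num.truncn z).
    split; [exact: ltnW (ltnW nz)|rewrite ler_norml; lra|].
    by rewrite mulr_ge0//; lra.
  exists (Num.truncn z).+1.
  split; [exact: ltnW (ltnW (ltnW nz))|rewrite ler_norml -natr1; lra|].
  by rewrite mulr_le0// -?natr1; lra.
have [s /andP[sj js]] := nat_sqrt j.
have As : (A.*2 <= s)%N.
  rewrite -ltnS -(ltn_exp2r _ _ (isT : (0 < 2)%N)); apply: leq_ltn_trans js.
  by apply: leq_trans Aj; rewrite -mul2n expnMn.
have s0 : (0 < s)%N by apply: leq_trans As.
have A1 : (1 < A)%N by [].
have [||k kK /andP[l1 l2]] :=
  @two_powers_crossing R theta A s j z th0 th1 A1 s0 WA sj _ _ zj1 zj.
- apply: leq_trans (ltnW js) _; rewrite -[4%N]/(2 ^ 2)%N -expnMn leq_exp2r//.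
  by rewrite mul2n -addnn -[s.+1]addn1 leq_add2l.
- apply: leq_trans sj.
  by rewrite -mul2n mulnA mul2n expnS expn1 leq_mul2r As orbT.
exists (diag_sum theta j k); first by exists (j + k)%N, (j - k)%N.
rewrite l1/=; apply: le_trans l2 _.
rewrite lerD2l -[leRHS]mulrA ler_wpM2l//.
  by rewrite !mulr_ge0 ?powR_ge0// ltW.
move: zj1; rewrite ler_norml => /andP[? ?].
by apply: powR_le_scale; lra.
Qed.

(** * The greedy construction *)

Lemma powR_sub_le (R : realType) (p a b : R) : 1 <= p -> 0 < a -> a <= b ->
  b <= a + 1 -> b `^ p - a `^ p <= p * b `^ (p - 1).
Proof.
move=> p1 a0 ab ba; have [c /andP[ac cb] ->] := @powR_sub_MVT R p a b a0 ab.
rewrite -mulrA ler_wpM2l//; first by lra.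
rewrite -[leRHS]mulr1 ler_pM ?powR_ge0//; [lra| |lra].
by apply: ge0_ler_powR; rewrite ?nnegrE//; lra.
Qed.

Lemma greedy_two_powers (R : realType) (theta : R) : 1 <= theta ->
  exists D : R, 0 < D /\ forall x : R, 1 <= x ->
    exists y : R, sums_of_two_powers theta y /\
      x <= y <= x + D * x `^ ((1 - theta^-1) ^+ 2).
Proof.
move=> th1; have th0 : 0 < theta by lra.
have thN0 : theta != 0 by rewrite gt_eqF.
have K0 := powR_ge0 theta theta^-1.
exists (theta * (theta `^ theta^-1 + 1) `^ (theta - 1)); split.
  by rewrite mulr_gt0// powR_gt0//; lra.
move=> x x1.
have [X X1 EX] : exists2 X, 1 <= X & X `^ theta = x.
  exists (x `^ theta^-1); last by rewrite -powRrM mulVf// powRr1//; lra.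
  by rewrite -[leLHS](powRr0 x) ler_powR// invr_ge0 ltW.
have X0 : 0 <= X by lra.
have /andP[uX Xu] := truncn_itv X0; rewrite -natr1 in Xu.
set u := Num.truncn X in uX Xu.
have u1 : 1 <= (u%:R : R) by rewrite ler1n truncn_gt0.
set r := x - u%:R `^ theta.
have r0 : 0 <= r.
  by rewrite subr_ge0 -EX; apply: ge0_ler_powR; rewrite ?nnegrE// ltW.
have rX : r <= theta * X `^ (theta - 1).
  by rewrite /r -[in leLHS]EX; apply: powR_sub_le; lra.
set w := r `^ theta^-1.
have Ew : w `^ theta = r by rewrite -powRrM mulVf// powRr1.
have w0 : 0 <= w by exact: powR_ge0.
have wK : w + 1 <= (theta `^ theta^-1 + 1) * X `^ ((theta - 1) / theta).
  have Y1 : 1 <= X `^ ((theta - 1) / theta).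
    by rewrite -[leLHS](powRr0 X) ler_powR// divr_ge0 ?subr_ge0// ltW.
  rewrite mulrDl mul1r lerD// powRrM -powRM ?powR_ge0//; last by lra.
  apply: ge0_ler_powR; rewrite ?nnegrE ?invr_ge0 ?mulr_ge0 ?powR_ge0//; lra.
(* For [r = 0] the choice [v = 0] is exact; the mean value theorem behind
   [powR_sub_le] needs a positive left end. *)
have [r0'|rN0] := eqVneq r 0.
  exists x; split; first exists u, 0%N.
    by rewrite powR0// addr0; move/eqP: r0'; rewrite subr_eq0 => /eqP.
  by rewrite lexx lerDl !mulr_ge0 ?powR_ge0// ltW.
have w0' : 0 < w by rewrite powR_gt0// lt_neqAle eq_sym rN0.
have /andP[vw wv] := truncn_itv w0.
set v := (Num.truncn w).+1 in wv.
have vw1 : v%:R <= w + 1 by rewrite -natr1; lra.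
exists (u%:R `^ theta + v%:R `^ theta); split; first by exists u, v.
have -> : x = u%:R `^ theta + w `^ theta by rewrite Ew /r; ring.
rewrite lerD2l -addrA lerD2l -lerBlDl; apply/andP; split.
  by apply: ge0_ler_powR; rewrite ?nnegrE// ltW.
have -> : u%:R `^ theta + w `^ theta = x by rewrite Ew /r; ring.
apply: le_trans (@powR_sub_le R theta w v%:R th1 w0' (ltW wv) vw1) _.
rewrite -[leRHS]mulrA ler_pM2l//.
have -> : x `^ ((1 - theta^-1) ^+ 2)
    = (X `^ ((theta - 1) / theta)) `^ (theta - 1).
  by rewrite -EX -!powRrM; congr (_ `^ _); field.
rewrite -powRM ?powR_ge0//; last by lra.
apply: ge0_ler_powR; rewrite ?nnegrE ?mulr_ge0 ?powR_ge0//; lra.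
Qed.

(** * Conclusion *)

(** On a bounded range [x^psi] is bounded below by a positive constant,
    whatever the sign of [psi], and the next pure power [v^theta + 0^theta] after
    [x] is bounded above. *)
Lemma two_powers_bounded_range (R : realType) (theta psi X0 : R) : 0 < theta ->
  exists D : R, 0 < D /\ forall x : R, 1 <= x <= X0 ->
    exists y : R, sums_of_two_powers theta y /\ x <= y <= x + D * x `^ psi.
Proof.
move=> th0; have thN0 : theta != 0 by rewrite gt_eqF.
have K0 := powR_ge0 X0 theta^-1.
have B0 : 0 < (X0 `^ theta^-1 + 1) `^ theta by rewrite powR_gt0//; lra.
have [X0p|X0n] := ltP X0 1.
  by exists 1; split=> // x /andP[x1 xX]; lra.
exists ((X0 `^ theta^-1 + 1) `^ theta * X0 `^ `|psi|).
split; first by rewrite mulr_gt0// powR_gt0//; lra.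
move=> x /andP[x1 xX].
set v := (Num.truncn (x `^ theta^-1)).+1.
have wx := powR_ge0 x theta^-1.
have /andP[vl vu] := truncn_itv wx; rewrite -/v in vu.
have xv : x <= v%:R `^ theta.
  have {1}-> : x = (x `^ theta^-1) `^ theta.
    by rewrite -powRrM mulVf// powRr1//; lra.
  by apply: ge0_ler_powR; rewrite ?nnegrE// ltW.
exists (v%:R `^ theta); split.
  by exists v, 0%N; rewrite powR0// addr0.
rewrite xv/= -lerBlDl; apply: le_trans (_ : v%:R `^ theta <= _); first by lra.
rewrite -mulrA -[leLHS]mulr1 ler_pM ?powR_ge0//.
  apply: ge0_ler_powR; rewrite ?nnegrE//; [exact: ltW|lra|].
  rewrite -natr1 lerD2r; apply: le_trans vl _.
  by apply: ge0_ler_powR; rewrite ?nnegrE ?invr_ge0; lra.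
have <- : 1 `^ psi = 1 :> R by rewrite powR1.
by apply: powR_le_scale; nra.
Qed.

Lemma diagonal_two_powers (R : realType) (theta : R) : 0 < theta ->
  theta != 1 -> exists D : R, 0 < D /\ forall x : R, 1 <= x ->
    exists y : R, sums_of_two_powers theta y /\
      x <= y <= x + D * x `^ (1 - 3 / (2 * theta)).
Proof.
move=> th0 th1; have thN0 : theta != 0 by rewrite gt_eqF.
set psi := 1 - _.
have [C [Z0 [C0 HC]]] := @two_powers_near_diagonal R theta th0 th1.
have [D1 [D10 HD1]] :=
  @two_powers_bounded_range R theta psi (2 * Z0%:R `^ theta) th0.
have h0 : 0 < (2^-1 : R) `^ psi by rewrite powR_gt0.
exists (D1 + C * 2^-1 `^ psi); split; first by rewrite addr_gt0// mulr_gt0.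
move=> x x1; have xp := powR_ge0 x psi.
have [xs|xl] := leP x (2 * Z0%:R `^ theta).
  have [|y [sy /andP[xy yx]]] := HD1 x; first by rewrite x1.
  exists y; split=> //; rewrite xy/=; apply: le_trans yx _.
  by rewrite lerD2l ler_wpM2r// lerDl mulr_ge0 ?ltW.
pose z := (x * 2^-1) `^ theta^-1.
have Ez : 2 * z `^ theta = x.
  by rewrite /z -powRrM mulVf// powRr1; [field|lra].
have Zz : Z0%:R <= z.
  have -> : Z0%:R = (Z0%:R `^ theta) `^ theta^-1 :> R.
    by rewrite -powRrM mulfV// powRr1.
  by apply: ge0_ler_powR; rewrite ?nnegrE ?invr_ge0 ?powR_ge0//; lra.
have [y sy] := HC z Zz.
have -> : z `^ (theta - 3 / 2) = x `^ psi * 2^-1 `^ psi.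
  rewrite /z -powRrM -powRM; [|lra|lra].
  by congr (_ `^ _); rewrite /psi; field.
rewrite Ez => /andP[xy yx].
exists y; split=> //; rewrite xy/=; apply: le_trans yx _.
by rewrite lerD2l mulrCA mulrC ler_wpM2r// lerDr ltW.
Qed.

Theorem theorem1p4 (R : realType) (theta : R) (htheta : 0 < theta) :
  exists D : R, 0 < D /\
    forall x : R, 1 <= x ->
      exists y : R, sums_of_two_powers theta y /\
        x <= y <= x + D * x `^ (Psi theta).
Proof.
rewrite /Psi; have [th1|th1|->] := ltgtP theta 1.
- by apply: diagonal_two_powers; rewrite ?lt_eqF.
- case: ltP => th2; first by apply: diagonal_two_powers; rewrite ?gt_eqF.
  have -> : 1 - 2 / theta + 1 / theta ^+ 2 = (1 - theta^-1) ^+ 2.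
    by field; rewrite gt_eqF.
  by apply: greedy_two_powers; rewrite ltW.
- by have := @greedy_two_powers R 1 (lexx 1); rewrite invr1 subrr expr0n.
Qed.
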